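(* Let $\{w_k\}_{k=1}^N\subseteq\mathbb{C}^d$ be an equiangular tight frame with $N\le 2d-2$. Then the unital entanglement breaking channel $\tau=\frac{d}{N}\sum_{k=1}^N\mathrm{Ad}_{|w_k\rangle\langle w_k|}$ is an extreme point of $\mathrm{UEBTP}(d)$, with Choi rank and EB rank both equal to $N$.
   Context: A set of unit vectors $\{w_k\}_{k=1}^N\subseteq\mathbb{C}^d$ (with $d\ge1$) is an equiangular tight frame (ETF) if $|\langle w_k,w_l\rangle|=\sqrt{\frac{N-d}{d(N-1)}}$ for all $1\le k<l\le N$, and $\sum_{k=1}^N|w_k\rangle\langle w_k|=\frac{N}{d}I_d$. $\mathbb{M}_d$ is the algebra of $d\times d$ complex matrices; $\mathrm{Ad}_V(X)=VXV^*$; $|x\rangle\langle y|$ is the rank-one operator $z\mapsto\langle y,z\rangle x$. A quantum channel on $\mathbb{M}_d$ is a completely positive (CP), trace-preserving linear map. A linear map $\varphi$ on $\mathbb{M}_d$ is entanglement breaking (EB) if for every $k\ge 1$ and every positive semidefinite $Z\in\mathbb{M}_d\otimes\mathbb{M}_k$, the matrix $(\varphi\otimes\mathrm{id}_k)(Z)$ is separable, i.e. a finite sum of $X_j\otimes Y_j$ with $X_j,Y_j$ positive semidefinite; equivalently, $\varphi=\sum_j\mathrm{Ad}_{V_j}$ (finite sum) with rank-one matrices $V_j$. $\mathrm{UEBTP}(d)$ is the compact convex set of all unital EB quantum channels on $\mathbb{M}_d$. The Choi rank of a CP map is the minimal number of matrices $V_j$ in a representation $\varphi=\sum_j\mathrm{Ad}_{V_j}$;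 the EB rank of an EB map is the minimal number of terms in such a representation with all $V_j$ of rank one. *)

(* Defs.v *)
From mathcomp Require Import all_boot all_order all_algebra.
From mathcomp Require Import complex mxtens.
From mathcomp Require Import reals.

Set Implicit Arguments.
Unset Strict Implicit.
Unset Printing Implicit Defensive.

Import Order.TTheory GRing.Theory Num.Theory.

Local Open Scope ring_scope.
Local Open Scope complex_scope.
Local Open Scope sesquilinear_scope.

Section Frames.
Variables (R : realType) (d : nat).
Implicit Types x y : 'cV[R[i]]_d.

(* Conjugate-linear in the first argument, so that ketbra x y *m z is
   inner y z *: x (see ketbraE). *)
Definition inner x y : R[i] := (x ^t* *m y) 0 0.

Definition ketbra x y : 'M[R[i]]_d := x *m y ^t*.

Lemma ketbraE x y z : ketbra x y *m z = inner y z *: x.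
Proof.
rewrite /ketbra -mulmxA [y ^t* *m z]mx11_scalar -/(inner y z).
by rewrite mul_mx_scalar.
Qed.

Definition equiangular_tight_frame (N : nat) (w : 'I_N -> 'cV[R[i]]_d) : Prop :=
  [/\ forall k, inner (w k) (w k) = 1,
      forall k l : 'I_N, (k < l)%N ->
        `|inner (w k) (w l)| =
          sqrtC ((N%:R - d%:R) / (d%:R * (N%:R - 1)))
    & \sum_(k < N) ketbra (w k) (w k) = (N%:R / d%:R)%:M].

End Frames.

Section Maps.
Variable R : realType.

(* In R[i], 0 <= z means that z is real and nonnegative; over the complex
   numbers this forces A to be Hermitian. *)
Definition psd (n : nat) (A : 'M[R[i]]_n) : Prop :=
  forall x : 'cV[R[i]]_n, 0 <= inner x (A *m x).

Definition separable (m k : nat) (Z : 'M[R[i]]_(m * k)) : Prop :=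
  exists (n : nat) (X : 'I_n -> 'M[R[i]]_m) (Y : 'I_n -> 'M[R[i]]_k),
    [/\ forall j, psd (X j), forall j, psd (Y j)
      & Z = \sum_(j < n) X j *t Y j].

Variable d : nat.
Implicit Type phi : 'End('M[R[i]]_d).

Definition Ad (V : 'M[R[i]]_d) : 'End('M[R[i]]_d) :=
  linfun (mulmxr (V ^t*) \o mulmx V).

Lemma AdE V X : Ad V X = V *m X *m V ^t*.
Proof. by rewrite /Ad lfunE. Qed.

Definition tens_block (k : nat) (Z : 'M[R[i]]_(d * k)) (a b : 'I_k) :
    'M[R[i]]_d :=
  \matrix_(i, j) Z (mxtens_index (i, a)) (mxtens_index (j, b)).

(* phi \otimes id_k: writing Z as the sum of the tens_block Z a b *t E_ab,
   phi is applied to each block (see tens_idE). *)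
Definition tens_id phi (k : nat) (Z : 'M[R[i]]_(d * k)) : 'M[R[i]]_(d * k) :=
  \sum_(a < k) \sum_(b < k) phi (tens_block Z a b) *t delta_mx a b.

Lemma tens_idE phi k (X : 'M[R[i]]_d) (Y : 'M[R[i]]_k) :
  tens_id phi (X *t Y) = phi X *t Y.
Proof.
apply/matrixP => i j.
case: (mxtens_indexP i) => i1 a; case: (mxtens_indexP j) => j1 b.
have blockE a' b' : tens_block (X *t Y) a' b' = Y a' b' *: X.
  by apply/matrixP => p q; rewrite !mxE !mxtens_indexK /= mulrC.
have entryE a' b' : (phi (tens_block (X *t Y) a' b') *t delta_mx a' b')
    (mxtens_index (i1, a)) (mxtens_index (j1, b)) =
    if (a' == a) && (b' == b) then (phi X *t Y) (mxtens_index (i1, a))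
      (mxtens_index (j1, b)) else 0.
  rewrite !tensmxE blockE linearZ !mxE [a == _]eq_sym [b == _]eq_sym.
  by case: eqP => [->|_]; case: eqP => [->|_]; rewrite ?mulr0 // mulr1 mulrC.
rewrite /tens_id summxE (eq_bigr (fun a' => if a' == a then
    (phi X *t Y) (mxtens_index (i1, a)) (mxtens_index (j1, b)) else 0)).
  by rewrite -big_mkcond big_pred1_eq.
move=> a' _; rewrite summxE (eq_bigr _ (fun b' _ => entryE a' b')).
by case: (a' == a) => /=; [rewrite -big_mkcond big_pred1_eq | rewrite big1].
Qed.

Definition completely_positive phi : Prop :=
  forall k (Z : 'M[R[i]]_(d * k)), (0 < k)%N -> psd Z -> psd (tens_id phi Z).

Definition trace_preserving phi : Prop := forall X, \tr (phi X) = \tr X.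

Definition quantum_channel phi : Prop :=
  completely_positive phi /\ trace_preserving phi.

Definition unital phi : Prop := phi 1%:M = 1%:M.

Definition entanglement_breaking phi : Prop :=
  forall k (Z : 'M[R[i]]_(d * k)), (0 < k)%N -> psd Z ->
    separable (tens_id phi Z).

Definition UEBTP phi : Prop :=
  [/\ quantum_channel phi, unital phi & entanglement_breaking phi].

Definition extreme_point (S : 'End('M[R[i]]_d) -> Prop) phi : Prop :=
  S phi /\
  forall (psi1 psi2 : 'End('M[R[i]]_d)) (t : R),
    S psi1 -> S psi2 -> 0 < t < 1 ->
    phi = t%:C *: psi1 + (1 - t)%:C *: psi2 -> psi1 = phi /\ psi2 = phi.

Definition is_minimum (P : nat -> Prop) (r : nat) : Prop :=
  P r /\ forall s, P s -> (r <= s)%N.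

Definition choi_rank_eq phi (r : nat) : Prop :=
  is_minimum (fun n => exists V : 'I_n -> 'M[R[i]]_d,
    phi = \sum_(j < n) Ad (V j)) r.

Definition EB_rank_eq phi (r : nat) : Prop :=
  is_minimum (fun n => exists V : 'I_n -> 'M[R[i]]_d,
    (forall j, \rank (V j) = 1%N) /\ phi = \sum_(j < n) Ad (V j)) r.

End Maps.

(* Main.v *)
(* Let tau = t psi1 + (1 - t) psi2 in UEBTP(d).  Each psi_i has rank-one Kraus
   operators, read off a separable decomposition of its Choi matrix, and
   positivity of the Choi matrices forces them into the span of the
   projections P_k = |w_k><w_k|.  The heart of the matter is that a combination
   sum_k x_k P_k of rank at most one has at most one nonzero coefficient.  If m
   coefficients are nonzero and r is the rank of the sum S of the corresponding
   P_k, then Frobenius' rank inequality gives 2 r <= m + 1, whereas Cauchy-Schwarz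
   for the eigenvalues of S gives r >= (tr S)^2 / tr S^2 = m / (1 + (m - 1) c),
   c being the common value of |<w_k, w_l>|^2.  For m >= 2 this forces
   (m + 1) c >= 1, whereas (N + 1) c < 1 is exactly N <= 2 d - 2.  Hence
   psi_i = sum_k p_k Ad(P_k); unitality and the linear independence of the P_k
   give p_k = d / N, and independence also bounds the number of Kraus operators
   of tau from below by N. *)

Require Import Defs.
From mathcomp Require Import all_boot all_order all_algebra.
From mathcomp Require Import complex mxtens.
From mathcomp Require Import reals ring zify.

Import Order.TTheory GRing.Theory Num.Theory.

Local Open Scope ring_scope.
Local Open Scope complex_scope.
Local Open Scope sesquilinear_scope.

Set Implicit Arguments.
Unset Strict Implicit.
Unset Printing Implicit Defensive.

(** * Rank of diagonal matrices *)

Lemma rank_diag_mx_le (F : fieldType) n (l : 'rV[F]_n) :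
  (\rank (diag_mx l) <= #|[pred i | l 0%R i != 0%R]|)%N.
Proof.
have rank_sum (I : finType) (A : I -> 'M[F]_n) :
    (\rank (\sum_i A i)%R <= \sum_i \rank (A i))%N.
  apply: (big_ind2 (fun (M : 'M[F]_n) k => \rank M <= k)%N) => //.
  - by rewrite mxrank0.
  - move=> A1 k1 A2 k2 le1 le2.
    exact: leq_trans (mxrank_add _ _) (leq_add le1 le2).
have -> : diag_mx l = \sum_i l 0 i *: delta_mx i i.
  apply/matrixP=> i j; rewrite summxE (bigD1 i) //= big1 => [|k /negPf ki].
    by rewrite !mxE eqxx addr0 [j == i]eq_sym; case: eqP; rewrite ?mulr1 ?mulr0.
  by rewrite !mxE [i == k]eq_sym ki mulr0.
apply: leq_trans (rank_sum _ _) _.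
rewrite -sum1_card [leqRHS]big_mkcond /=; apply: leq_sum => i _; rewrite inE.
case: eqP => [->|/eqP nz]; first by rewrite scale0r mxrank0.
by rewrite mxrank_scale_nz ?mxrank_delta.
Qed.

(** For the lower bound, the indicators [e] of the support and [l'] of its complement give diagonal
    matrices summing to the identity, so their ranks add up to at least [n]. *)
Lemma rank_diag_mx (F : fieldType) n (l : 'rV[F]_n) :
  \rank (diag_mx l) = #|[pred i | l 0%R i != 0%R]|.
Proof.
apply/eqP; rewrite eqn_leq rank_diag_mx_le /=.
pose e : 'rV[F]_n := \row_i (l 0 i != 0)%:R.
pose l' : 'rV[F]_n := \row_i (l 0 i == 0)%:R.
have le : (\rank (diag_mx e) <= \rank (diag_mx l))%N.
  (* As [0^-1] is [0], multiplying by the inverse entries turns [l] into [e]. *)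
  rewrite (_ : diag_mx e = diag_mx l *m diag_mx (\row_i (l 0 i)^-1)).
    exact: mxrankM_maxl.
  rewrite mulmx_diag; congr diag_mx; apply/rowP=> i; rewrite !mxE.
  by case: eqP => [->|/eqP /divff ->]; rewrite ?mul0r.
apply: leq_trans le; rewrite -(leq_add2r (\rank (diag_mx l'))).
have sum1 : diag_mx e + diag_mx l' = 1%:M.
  rewrite -linearD /= -diag_const_mx; congr diag_mx; apply/rowP=> i.
  by rewrite !mxE; case: eqP; rewrite ?addr0 ?add0r.
have := mxrank_add (diag_mx e) (diag_mx l'); rewrite sum1 mxrank1 => le_n.
apply: leq_trans le_n.
rewrite -[X in (_ <= X)%N]card_ord -(cardC [pred i | l 0%R i != 0%R]) leq_add2l.
apply: leq_trans (rank_diag_mx_le _) _; apply: subset_leq_card.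
apply/subsetP=> i; rewrite !inE mxE; by case: (l 0 i == 0); rewrite //= eqxx.
Qed.

(** * Spectrum, traces and rank of Hermitian matrices *)

Section ClosedField.
Variable C : numClosedFieldType.

Lemma adjmxM m n p (A : 'M[C]_(m, n)) (B : 'M[C]_(n, p)) :
  (A *m B) ^t* = B ^t* *m A ^t*.
Proof. by rewrite trmx_mul map_mxM. Qed.

Lemma hermitian_spectral n (A : 'M[C]_n) : A ^t* = A ->
  exists2 P : 'M[C]_n, P *m P ^t* = 1%:M &
  exists2 l : 'rV[C]_n, (forall i, l 0 i \is Num.real)
                      & A = P ^t* *m diag_mx l *m P.
Proof.
move=> hA; have herm : A \is hermsymmx.
  by apply/is_hermitianmxP; rewrite expr0 scale1r [RHS]hA.
exists (spectralmx A); first exact/unitarymxP/spectral_unitarymx.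
exists (spectral_diag A).
  by move=> i; have /mxOverP := hermitian_spectral_diag_real herm; apply.
rewrite -invmx_unitary ?spectral_unitarymx //.
exact/orthomx_spectralP/hermitian_normalmx.
Qed.

(* Cauchy-Schwarz for the vector of nonzero eigenvalues. *)
Lemma mxtrace_sqr_le_rank n (A : 'M[C]_n) : A ^t* = A ->
  (\tr A) ^+ 2 <= \tr (A *m A) * (\rank A)%:R.
Proof.
move=> /hermitian_spectral[P PP [l lreal defA]].
have PP' : P ^t* *m P = 1%:M by exact: mulmx1C.
have Punit : P \in unitmx by case/mulmx1_unit: PP.
have P'unit : P ^t* \in unitmx by case/mulmx1_unit: PP'.
have rA : \rank A = #|[pred i | l 0%R i != 0%R]|.
  rewrite defA mxrankMfree ?row_free_unit //.
  by rewrite eqmxMfull ?row_full_unit // rank_diag_mx.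
have trA : \tr A = \sum_i l 0 i.
  by rewrite defA mxtrace_mulC mulmxA PP mul1mx mxtrace_diag.
have trAA : \tr (A *m A) = \sum_i l 0 i ^+ 2.
  rewrite defA mulmxA mxtrace_mulC !mulmxA PP mul1mx.
  rewrite -[diag_mx l *m P *m _]mulmxA PP mulmx1 mulmx_diag mxtrace_diag.
  by apply: eq_bigr => i _; rewrite mxE expr2.
rewrite rA; set S := [pred i | _].
set a := \tr A in trA *; set b := \tr _ in trAA *; set r := (_)%:R.
have b_ge0 : 0 <= b.
  by rewrite trAA sumr_ge0 // => i _; rewrite real_exprn_even_ge0.
have areal : a \is Num.real by rewrite trA rpred_sum.
have aS : a = \sum_(i in S) l 0 i.
  rewrite trA [RHS]big_mkcond; apply: eq_bigr => i _.
  by rewrite inE; case: eqP.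
have bS : b = \sum_(i in S) l 0 i ^+ 2.
  rewrite trAA [RHS]big_mkcond; apply: eq_bigr => i _.
  by rewrite inE; case: eqP => // ->; rewrite expr0n.
have [b0|b_neq0] := eqVneq b 0.
  have: \sum_i l 0 i ^+ 2 == 0 by rewrite -trAA b0.
  rewrite psumr_eq0 => [/allP l0|i _]; last first.
    by rewrite real_exprn_even_ge0.
  rewrite b0 mul0r trA big1 ?expr0n // => i _; apply/eqP.
  by have := l0 i (mem_index_enum _); rewrite sqrf_eq0.
have b_gt0 : 0 < b by rewrite lt_def b_neq0.
(* These squares sum to [b * (b * r - a ^+ 2)], and [b > 0] can be cancelled. *)
have : 0 <= \sum_(i in S) (l 0 i * a - b) ^+ 2.
  apply: sumr_ge0 => i _; apply: real_exprn_even_ge0 => //.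
  by apply: realB; [exact: realM | exact: ger0_real].
have -> : \sum_(i in S) (l 0 i * a - b) ^+ 2 = b * (b * r - a ^+ 2).
  rewrite (eq_bigr (fun i => l 0 i ^+ 2 * a ^+ 2 - l 0 i * (a * b *+ 2) + b ^+ 2)).
    rewrite big_split sumrB /= -!mulr_suml -aS -bS sumr_const -mulr_natr -/r; ring.
  by move=> i _; ring.
by rewrite pmulr_rge0 // subr_ge0.
Qed.

End ClosedField.

(** * Linear combinations of equiangular rank-one projections *)

Section Coherence.
Variables (R : realType) (d N : nat) (w : 'I_N -> 'cV[R[i]]_d).

Definition frame_mx : 'M[R[i]]_(d, N) := \matrix_(i, k) w k i 0.

(** A triple product is the form to which Frobenius' inequality applies. *)
Lemma mul_frame_diag (x : 'rV[R[i]]_N) :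
  frame_mx *m diag_mx x *m frame_mx ^t* = \sum_k x 0 k *: ketbra (w k) (w k).
Proof.
apply/matrixP=> i j; rewrite summxE !mxE; apply: eq_bigr => k _.
rewrite mul_mx_diag /ketbra !mxE big_ord1 !mxE; ring.
Qed.

Lemma inner_conj (x y : 'cV[R[i]]_d) : inner x y = (inner y x)^*%R.
Proof.
rewrite /inner !mxE rmorph_sum; apply: eq_bigr => i _.
by rewrite !mxE rmorphM /= conjCK mulrC.
Qed.

Lemma mxtrace_ketbra (x y : 'cV[R[i]]_d) : \tr (ketbra x y) = inner y x.
Proof. by rewrite /ketbra mxtrace_mulC /mxtrace big_ord1. Qed.

Lemma mxtrace_ketbraM (x y : 'cV[R[i]]_d) :
  \tr (ketbra x x *m ketbra y y) = `|inner x y| ^+ 2.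
Proof.
rewrite normCK /ketbra -mulmxA [x ^t* *m (_ *m _)]mulmxA [x ^t* *m y]mx11_scalar.
rewrite mul_scalar_mx -scalemxAr mxtraceZ mxtrace_ketbra.
by rewrite -/(inner x y) [inner y x]inner_conj.
Qed.

(* E below is the indicator of the support of x, so W E W^* is the sum of the
   projections that occur in the combination. *)
Lemma rank1_comb_support (c : R[i]) (x : 'rV[R[i]]_N) :
    (forall k, inner (w k) (w k) = 1) ->
    (forall k l, k != l -> `|inner (w k) (w l)| ^+ 2 = c) ->
    N.+1%:R * c < 1 ->
    (\rank (\sum_k x 0%R k *: ketbra (w k) (w k))%R <= 1)%N ->
  (#|[pred k | x 0%R k != 0%R]| <= 1)%N.
Proof.
move=> unit_w coh Nc; rewrite -mul_frame_diag => rk1.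
set W := frame_mx in rk1 *; set S := [pred k | _].
set m := #|S|; rewrite leqNgt; apply/negP=> m_gt1.
pose e : 'rV[R[i]]_N := \row_k (x 0 k != 0)%:R.
pose x' : 'rV[R[i]]_N := \row_k (x 0 k)^-1.
have exx' : diag_mx e = diag_mx x *m diag_mx x'.
  rewrite mulmx_diag; congr diag_mx; apply/rowP=> k; rewrite !mxE.
  by case: eqP => [->|/eqP /divff ->]; rewrite ?mul0r.
have ex'x : diag_mx e = diag_mx x' *m diag_mx x by rewrite exx' diag_mxC.
set G := W *m diag_mx e *m W ^t*; set r := \rank G.
(* [G] factors through both [W *m diag_mx x] and [diag_mx x *m W ^t*]; Frobenius bounds the sum of
   their ranks by [m] plus the rank of the given combination. *)
have le_r : (r.*2 <= m.+1)%N.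
  have leL : (r <= \rank (W *m diag_mx x))%N.
    by rewrite /r /G exx' !mulmxA -mulmxA mxrankM_maxl.
  have leR : (r <= \rank (diag_mx x *m W ^t*))%N.
    by rewrite /r /G ex'x -!mulmxA !mulmxA -mulmxA mxrankM_maxr.
  have := mxrank_Frobenius W (diag_mx x) (W ^t*).
  rewrite rank_diag_mx -addnn => Fr.
  apply: leq_trans (leq_add leL leR) (leq_trans Fr _).
  by rewrite -[m.+1]addn1 leq_add2l.
have GE : G = \sum_(k in S) ketbra (w k) (w k).
  rewrite /G mul_frame_diag [RHS]big_mkcond; apply: eq_bigr => k _.
  by rewrite inE mxE; case: eqP; rewrite ?scale0r ?scale1r.
have adjG : G ^t* = G.
  rewrite /G !adjmxM trmxCK -mulmxA; congr (_ *m (_ *m _)).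
  rewrite tr_diag_mx map_diag_mx; congr diag_mx.
  by apply/rowP=> k; rewrite !mxE rmorph_nat.
have trG : \tr G = m%:R.
  rewrite GE raddf_sum /= -sumr_const; apply: eq_bigr => k _.
  by rewrite mxtrace_ketbra unit_w.
(* The [m] equal pairs contribute 1 each, the [m (m - 1)] ordered pairs of distinct indices [c]
   each. *)
have trGG : \tr (G *m G) = m%:R * (1 + (m%:R - 1) * c).
  rewrite GE mulmx_suml raddf_sum /= mulr_natl -sumr_const.
  apply: eq_bigr => k kS.
  rewrite mulmx_sumr raddf_sum /= (bigD1 k) //= mxtrace_ketbraM unit_w normr1 expr1n.
  congr (_ + _); rewrite (eq_bigr (fun=> c)) => [|l /andP[_ lk]]; last first.
    by rewrite mxtrace_ketbraM coh // eq_sym.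
  rewrite sumr_const -[LHS]mulr_natl; congr (_ * c).
  rewrite /m [#|S|](cardD1 k) kS natrD addrAC subrr add0r; congr _%:R.
  by apply: eq_card => l; rewrite !inE andbC.
have c_ge0 : 0 <= c.
  have [k kS] : exists k, k \in S by apply/card_gt0P; apply: ltnW.
  have [l] : exists l, l \in [predD1 S & k].
    by apply/card_gt0P; move: m_gt1; rewrite /m [#|S|](cardD1 k) kS.
  by rewrite !inE => /andP[lk _]; rewrite -(coh _ _ lk) exprn_ge0.
have := mxtrace_sqr_le_rank adjG; rewrite trG trGG -/r.
set q := 1 + _ => le_mr.
have q_ge0 : 0 <= q.
  rewrite addr_ge0 // mulr_ge0 // subr_ge0 ler1n; exact: ltnW.
have : m%:R ^+ 2 *+ 2 <= m%:R * q * m.+1%:R :> R[i].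
  apply: le_trans (_ : m%:R * q * r.*2%:R <= _).
    by rewrite -muln2 natrM mulrA mulr_natr lerMn2r.
  by rewrite ler_wpM2l ?ler_nat // mulr_ge0.
rewrite -subr_ge0.
(* For [m > 1] this factorization gives [(m + 1) c >= 1], contrary to [Nc] since [m <= N]. *)
have -> : m%:R * q * m.+1%:R - m%:R ^+ 2 *+ 2 =
    m%:R * (m%:R - 1) * (m.+1%:R * c - 1) :> R[i].
  rewrite /q -natr1; ring.
rewrite pmulr_rge0; last by rewrite mulr_gt0 ?subr_gt0 ?ltr0n ?ltr1n // ltnW.
rewrite subr_ge0 => /le_lt_trans/(_ (le_lt_trans _ Nc)).
have -> : m.+1%:R * c <= N.+1%:R * c.
  rewrite ler_wpM2r // ler_nat ltnS /m -[leqRHS]card_ord; exact: max_card.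
by move=> /(_ isT); rewrite ltxx.
Qed.

Hypotheses (unit_w : forall k, inner (w k) (w k) = 1) (c : R[i])
  (coh : forall k l, k != l -> `|inner (w k) (w l)| ^+ 2 = c)
  (Nc : N.+1%:R * c < 1).

Lemma rank1_combP (x : 'rV[R[i]]_N) : (0 < N)%N ->
  (\rank (\sum_k x 0%R k *: ketbra (w k) (w k))%R <= 1)%N ->
  exists k a, \sum_k x 0 k *: ketbra (w k) (w k) = a *: ketbra (w k) (w k).
Proof.
move=> N_gt0 /(rank1_comb_support unit_w coh Nc) S1.
case: (pickP [pred k | x 0 k != 0]) => [k kS|S0]; last first.
  exists (Ordinal N_gt0), 0; rewrite scale0r big1 // => k _.
  by have /negbFE/eqP-> := S0 k; rewrite scale0r.
exists k, (x 0 k); rewrite (bigD1 k) //= big1 ?addr0 // => l lk.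
suff /eqP-> : x 0 l == 0 by rewrite scale0r.
apply: contraNT lk => lS; apply/eqP.
by have /card_le1_eqP := S1; apply.
Qed.

(** The zero matrix has rank at most one, so at most one term survives; applying it to the unit
    vector [w k] kills its coefficient. *)
Lemma ketbra_free (x : 'rV[R[i]]_N) :
  \sum_k x 0 k *: ketbra (w k) (w k) = 0 -> x = 0.
Proof.
move=> x0; have : (\rank (\sum_k x 0%R k *: ketbra (w k) (w k))%R <= 1)%N.
  by rewrite x0 mxrank0.
move=> /(rank1_comb_support unit_w coh Nc) S1.
apply/rowP=> k; rewrite mxE; apply/eqP; apply: contraT => kS.
move: x0; rewrite (bigD1 k) //= big1 ?addr0 => [xk0|l lk]; last first.
  suff /eqP-> : x 0 l == 0 by rewrite scale0r.
  apply: contraNT lk => lS; apply/eqP.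
  by have /card_le1_eqP := S1; apply.
have := congr1 (fun M => M *m w k) xk0.
rewrite mul0mx -scalemxAl ketbraE unit_w scale1r => /eqP.
rewrite scaler_eq0 (negPf kS) /= => /eqP wk0.
have := unit_w k; rewrite wk0 /inner mulmx0 mxE => /eqP.
by rewrite eq_sym oner_eq0.
Qed.

End Coherence.

(** * Choi forms and the span of Kraus operators *)

Section Kraus.
Variables (R : realType) (d : nat).
Implicit Types (phi : 'End('M[R[i]]_d)) (V B : 'M[R[i]]_d).

Lemma eq_End_delta (phi psi : 'End('M[R[i]]_d)) :
  (forall a b, phi (delta_mx a b) = psi (delta_mx a b)) -> phi = psi.
Proof.
move=> eq_delta; apply/lfunP=> X; rewrite [X]matrix_sum_delta !linear_sum.
apply: eq_bigr => a _; rewrite !linear_sum; apply: eq_bigr => b _.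
by rewrite !linearZ /= eq_delta.
Qed.

Lemma Ad_scale (a : R[i]) V : Ad (a *: V) = `|a| ^+ 2 *: Ad V.
Proof.
apply/lfunP=> X; rewrite scale_lfunE !AdE linearZ map_mxZ /= -!scalemxAl.
by rewrite -scalemxAr scalerA normCK.
Qed.

Lemma Ad_ketbra (x y : 'cV[R[i]]_d) X :
  Ad (ketbra x y) X = inner y (X *m y) *: ketbra x x.
Proof.
rewrite AdE /ketbra adjmxM trmxCK -!mulmxA.
rewrite [X *m (_ *m _)]mulmxA [y ^t* *m (_ *m _)]mulmxA.
by rewrite [y ^t* *m (X *m y)]mx11_scalar mul_scalar_mx scalemxAr.
Qed.

Lemma Ad_deltaE V a b i j :
  Ad V (delta_mx a b) i j = V i a * (V j b)^*%R.
Proof.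
rewrite AdE -(mul_delta_mx (0 : 'I_1)) mulmxA -colE -mulmxA -rowE.
by rewrite !mxE big_ord1 !mxE.
Qed.

(* The quadratic form of the Choi matrix of phi, evaluated at the conjugate
   of the vectorisation of B. *)
Definition choi_form phi B : R[i] :=
  \sum_i \sum_j \sum_p \sum_q B i j * (B p q)^*%R * phi (delta_mx j q) i p.

Lemma choi_form_Ad V B : choi_form (Ad V) B = `|\tr (V *m B^T)| ^+ 2.
Proof.
have trE : \tr (V *m B^T) = \sum_i \sum_j V i j * B i j.
  by apply: eq_bigr => i _; rewrite mxE; apply: eq_bigr => j _; rewrite mxE.
rewrite normCK trE rmorph_sum mulr_suml; apply: eq_bigr => i _.
rewrite mulr_suml; apply: eq_bigr => j _.
rewrite mulr_sumr; apply: eq_bigr => p _.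
rewrite rmorph_sum mulr_sumr; apply: eq_bigr => q _.
rewrite Ad_deltaE rmorphM /=; ring.
Qed.

Lemma choi_form_sum (s : seq 'M[R[i]]_d) B :
  choi_form (\sum_(V <- s) Ad V) B = \sum_(V <- s) `|\tr (V *m B^T)| ^+ 2.
Proof.
rewrite (big_morph (choi_form^~ B) (id1 := 0) (op1 := +%R)) => [|phi psi|].
- by apply: eq_bigr => V _; rewrite choi_form_Ad.
- rewrite /choi_form -big_split; apply: eq_bigr => i _.
  rewrite -big_split; apply: eq_bigr => j _.
  rewrite -big_split; apply: eq_bigr => p _.
  by rewrite -big_split; apply: eq_bigr => q _; rewrite add_lfunE mxE mulrDr.
rewrite /choi_form big1 // => i _; rewrite big1 // => j _; rewrite big1 // => p _.
by rewrite big1 // => q _; rewrite zero_lfunE mxE mulr0.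
Qed.

(** If [\tr (K k *m B^T)] vanishes for all [k], so does the Choi form at [B]. Computed from [s],
    that form is a sum of squared moduli, so [B] annihilates each [V] of [s] as well. *)
Lemma kraus_span n (K : 'I_n -> 'M[R[i]]_d) (s : seq 'M[R[i]]_d) :
  \sum_k Ad (K k) = \sum_(V <- s) Ad V ->
  forall V, V \in s -> exists x : 'rV[R[i]]_n, V = \sum_k x 0 k *: K k.
Proof.
move=> KV V Vs; pose Kmx := \matrix_k mxvec (K k).
have /submxP[x Vx] : (mxvec V <= Kmx)%MS.
  rewrite submxE; apply/eqP/rowP=> j; rewrite [RHS]mxE.
  (* A column of the cokernel, reshaped as a matrix, annihilates every [K k]. *)
  pose B := vec_mx (col j (cokermx Kmx))^T.
  have dotB M : (mxvec M *m cokermx Kmx) 0 j = \tr (M *m B^T).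
    rewrite mxE (reindex _ (curry_mxvec_bij _ _)) /=.
    transitivity (\sum_p \sum_q M p q * cokermx Kmx (mxvec_index p q) j).
      by rewrite pair_bigA; apply: eq_bigr => -[p q] _ /=; rewrite mxvecE.
    apply: eq_bigr => p _; rewrite mxE; apply: eq_bigr => q _.
    by rewrite !mxE.
  have /eqP : \sum_(V <- s) `|\tr (V *m B^T)| ^+ 2 = 0.
    rewrite -choi_form_sum -KV -(big_map K predT (@Ad R d)) choi_form_sum.
    rewrite big_map big1 // => k _; rewrite -dotB.
    rewrite -[mxvec _](rowK (fun k => mxvec (K k))) -row_mul mulmx_coker.
    by rewrite !mxE normr0 expr0n.
  rewrite psumr_eq0 => [/allP/(_ _ Vs)|? _]; last exact: exprn_ge0.
  by rewrite /= sqrf_eq0 normr_eq0 dotB => /eqP.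
exists x; rewrite -[V]mxvecK Vx mulmx_sum_row linear_sum.
by apply: eq_bigr => k _; rewrite linearZ /= rowK mxvecK.
Qed.

(** Zero operators are allowed, since a product vector with a zero factor produces one. *)
Definition rank1_kraus phi : Prop :=
  exists2 s : seq 'M[R[i]]_d,
    forall V, V \in s -> (\rank V <= 1)%N & phi = \sum_(V <- s) Ad V.

End Kraus.

(** * Positive semidefinite matrices, separability and the Choi matrix *)

Section Positive.
Variable R : realType.

Lemma psd_ketbra n (x : 'cV[R[i]]_n) : psd (ketbra x x).
Proof.
move=> y; rewrite ketbraE /inner -scalemxAr mxE -!/(inner _ _) inner_conj.
by rewrite mulrC -normCK exprn_ge0.
Qed.

Lemma psd_sum n (I : Type) (s : seq I) (A : I -> 'M[R[i]]_n) :
  (forall k, psd (A k)) -> psd (\sum_(k <- s) A k).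
Proof.
move=> psdA x; rewrite mulmx_suml /inner mulmx_sumr summxE.
by apply: sumr_ge0 => k _; exact: psdA.
Qed.

(* A form that is real on the diagonal is Hermitian, by polarization. *)
Lemma psd_hermitian n (A : 'M[R[i]]_n) : psd A -> A ^t* = A.
Proof.
move=> psdA; pose D := A - A ^t*.
pose f (x y : 'cV[R[i]]_n) := inner x (D *m y).
have fD x y x' y' : f (x + x') (y + y') = f x y + f x y' + f x' y + f x' y'.
  rewrite /f /inner mulmxDr [(x + x')^T]linearD map_mxD.
  by rewrite mulmxDl !mulmxDr !mxE !addrA.
have fZ a b x y : f (a *: x) (b *: y) = a^*%R * b * f x y.
  rewrite /f /inner -scalemxAr [(a *: x)^T]linearZ map_mxZ /=.
  by rewrite -scalemxAl -scalemxAr scalerA mxE.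
have f0 x : f x x = 0.
  rewrite /f /inner /D mulmxBl mulmxBr mxE [in X in _ + X]mxE -!/(inner _ _).
  have -> : inner x (A ^t* *m x) = (inner x (A *m x))^*%R.
    by rewrite inner_conj /inner adjmxM trmxCK mulmxA.
  by rewrite geC0_conj ?subrr.
have fxy x y : f x y = 0.
  have := f0 (x + y); rewrite fD !f0 add0r addr0 => /eqP.
  rewrite addr_eq0 => /eqP fyx.
  (* The vector [x + y] gave [f x y = - f y x]; now [x + i y] gives [f x y = f y x]. *)
  have := f0 (x + 'i%R *: y); rewrite fD !f0 add0r addr0.
  have := fZ 1 'i%R x y; rewrite scale1r => ->.
  have := fZ 'i%R 1 y x; rewrite scale1r => ->.
  rewrite -[f y x]opprK -fyx rmorph1 mul1r mulr1 conjCi mulrN mulNr opprK.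
  move/eqP; rewrite -mulr2n mulrn_eq0 /= mulf_eq0 (negPf (neq0Ci _)) /=.
  by move/eqP.
apply/eqP; rewrite eq_sym -subr_eq0 -/D; apply/eqP/matrixP=> i j.
rewrite [RHS]mxE -(fxy (delta_mx i 0) (delta_mx j 0)).
by rewrite /f /inner trmx_delta map_delta_mx mulmxA -rowE -colE !mxE.
Qed.

(** Spectral decomposition, with the square roots of the eigenvalues absorbed into the
    eigenvectors. *)
Lemma psd_sum_ketbra n (A : 'M[R[i]]_n) : psd A ->
  exists x : 'I_n -> 'cV[R[i]]_n, A = \sum_k ketbra (x k) (x k).
Proof.
move=> psdA; have [P PP [l _ defA]] := hermitian_spectral (psd_hermitian psdA).
have l_ge0 k : 0 <= l 0 k.
  have := psdA (P ^t* *m delta_mx k 0).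
  rewrite /inner adjmxM trmxCK defA !mulmxA -[_ *m P *m P ^t*]mulmxA PP mulmx1.
  rewrite -[_ *m P *m P ^t*]mulmxA PP mulmx1 -colE.
  rewrite trmx_delta map_delta_mx -rowE !mxE.
  by rewrite eqxx mulr1n.
exists (fun k => sqrtC (l 0 k) *: (row k P)^t*).
rewrite defA; apply/matrixP=> i j; rewrite summxE mxE; apply: eq_bigr => k _.
rewrite mul_mx_diag /ketbra !mxE big_ord1 !mxE rmorphM /= conjCK.
rewrite [(sqrtC _)^*%R]geC0_conj ?sqrtC_ge0 //.
rewrite -{1}(sqrtCK (l 0 k)); ring.
Qed.

Lemma separable_sum_ketbra m k (Z : 'M[R[i]]_(m * k)) : separable Z ->
  exists s : seq ('cV[R[i]]_m * 'cV[R[i]]_k),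
    Z = \sum_(p <- s) ketbra p.1 p.1 *t ketbra p.2 p.2.
Proof.
case=> n [X [Y [psdX psdY ->]]].
apply: (big_ind (fun Z : 'M[R[i]]_(m * k) =>
  exists s : seq ('cV[R[i]]_m * 'cV[R[i]]_k),
    Z = \sum_(p <- s) ketbra p.1 p.1 *t ketbra p.2 p.2)).
- by exists [::]; rewrite big_nil.
- by move=> _ _ [s ->] [t ->]; exists (s ++ t); rewrite big_cat.
move=> l _; have [x ->] := psd_sum_ketbra (psdX l).
have [y ->] := psd_sum_ketbra (psdY l).
exists [seq (x i, y j) | i <- index_enum 'I_m, j <- index_enum 'I_k].
rewrite big_allpairs_dep /=; apply/matrixP=> i j.
case: (mxtens_indexP i) => i1 a; case: (mxtens_indexP j) => j1 b.
rewrite tensmxE !summxE mulr_suml; apply: eq_bigr => p _.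
rewrite mulr_sumr summxE; apply: eq_bigr => q _.
by rewrite tensmxE.
Qed.

Lemma separable_psd m k (Z : 'M[R[i]]_(m * k)) : separable Z -> psd Z.
Proof.
case/separable_sum_ketbra=> s ->; apply: psd_sum => -[x y] /=.
rewrite /ketbra -tensmx_mul -map_mxT -trmx_tens.
exact: (psd_ketbra (x *t y)).
Qed.

Variable d : nat.
Implicit Type phi : 'End('M[R[i]]_d).

Lemma entanglement_breaking_CP phi :
  entanglement_breaking phi -> completely_positive phi.
Proof. by move=> EB k Z k_gt0 /EB-/(_ k_gt0)/separable_psd. Qed.

Lemma tens_id_mxE phi k (Z : 'M[R[i]]_(d * k)) i j a b :
  tens_id phi Z (mxtens_index (i, a)) (mxtens_index (j, b)) =
    phi (tens_block Z a b) i j.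
Proof.
rewrite /tens_id summxE (bigD1 a) //= summxE (bigD1 b) //=.
rewrite tensmxE mxE !eqxx mulr1.
rewrite !big1 ?addr0 // => [a' a'a|b' b'b].
  by rewrite summxE big1 // => b' _; rewrite tensmxE mxE eq_sym (negPf a'a) mulr0.
by rewrite tensmxE mxE [b == _]eq_sym (negPf b'b) andbF mulr0.
Qed.

(* A separable decomposition of the Choi matrix gives the Holevo form. *)
Lemma entanglement_breaking_kraus phi : (0 < d)%N ->
  entanglement_breaking phi -> rank1_kraus phi.
Proof.
move=> d_gt0 EB.
(* The unnormalized maximally entangled vector: the blocks of its projection are the matrix units,
   so [tens_id phi] yields the Choi matrix of [phi]. *)
pose omega : 'cV[R[i]]_(d * d) :=
  \col_k ((mxtens_unindex k).1 == (mxtens_unindex k).2)%:R.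
have [s choiE] := separable_sum_ketbra (EB d _ d_gt0 (psd_ketbra omega)).
have blockE a b : tens_block (ketbra omega omega) a b = delta_mx a b.
  apply/matrixP=> i j; rewrite !mxE big_ord1 !mxE !mxtens_indexK /= rmorph_nat.
  by rewrite -natrM mulnb.
(* The product of [ketbra x x] and [ketbra y y] is the Choi matrix of [Ad (x *m y^T)], with a plain
   transpose. *)
exists [seq p.1 *m p.2^T | p <- s].
  move=> V /mapP[p _ ->]; apply: leq_trans (mxrankM_maxl _ _) _.
  exact: rank_leq_col.
apply: eq_End_delta => a b; apply/matrixP=> i j.
rewrite -blockE -tens_id_mxE choiE blockE sum_lfunE !summxE big_map.
apply: eq_bigr => -[x y] _ /=.
rewrite tensmxE Ad_deltaE /ketbra !mxE !big_ord1 !mxE.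
rewrite !rmorphM /=; ring.
Qed.


End Positive.

(** * Compressions, and entanglement breaking for sums of rank-one projections *)

Section Compression.
Variables (R : realType) (d k : nat).

Lemma sum_mxtens (F : 'I_(d * k) -> R[i]) :
  \sum_i F i = \sum_i \sum_a F (mxtens_index (i, a)).
Proof.
rewrite pair_bigA (reindex (@mxtens_index d k)) /=; last first.
  by exists (@mxtens_unindex d k) => ? _; rewrite ?mxtens_indexK ?mxtens_unindexK.
by apply: eq_bigr => -[].
Qed.

(* The compression (<w| \otimes 1) Z (|w> \otimes 1). *)
Definition compress_mx (Z : 'M[R[i]]_(d * k)) (w : 'cV[R[i]]_d) : 'M[R[i]]_k :=
  \matrix_(a, b) inner w (tens_block Z a b *m w).

(** The form of the compression at [v] is the form of [Z] at the product vector [w *t v]. *)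
Lemma psd_compress_mx Z w : psd Z -> psd (compress_mx Z w).
Proof.
move=> psdZ v.
suff <- : inner (w *t v) (Z *m (w *t v)) = inner v (compress_mx Z w *m v).
  exact: psdZ.
have wvE i a (o : 'I_1) : (w *t v) (mxtens_index (i, a)) o = w i 0 * v a 0.
  by rewrite mxE mxtens_indexK /= !ord1.
have ZE a b : compress_mx Z w a b = \sum_i \sum_j
    (w i 0)^*%R * Z (mxtens_index (i, a)) (mxtens_index (j, b)) * w j 0.
  rewrite mxE /inner mxE; apply: eq_bigr => i _.
  rewrite [(_ *m w) i 0]mxE mulr_sumr; apply: eq_bigr => j _.
  by rewrite !mxE mulrA.
rewrite /inner mxE sum_mxtens exchange_big mxE; apply: eq_bigr => a _.
rewrite [(compress_mx Z w *m v) a 0]mxE [RHS]mulr_sumr.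
under [RHS]eq_bigr do rewrite ZE mulr_suml mulr_sumr.
rewrite exchange_big; apply: eq_bigr => i _ /=.
rewrite [(Z *m _) _ _]mxE sum_mxtens exchange_big mulr_sumr.
apply: eq_bigr => b _ /=.
rewrite !mulr_sumr mulr_suml mulr_sumr; apply: eq_bigr => j _.
rewrite !(wvE, mxE) !rmorphM /=; ring.
Qed.

End Compression.

Section RankOneProjections.
Variables (R : realType) (d n : nat) (w : 'I_n -> 'cV[R[i]]_d).

(** By [Ad_ketbra], the term of index [l] sends [Z] to the projection on [w l] tensored with the
    compression of [Z] along [w l]. *)
Lemma sum_Ad_ketbra_EB (c : R[i]) : 0 <= c ->
  entanglement_breaking (c *: \sum_k Ad (ketbra (w k) (w k))).
Proof.
move=> c_ge0 k Z k_gt0 psdZ.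
exists n, (fun l => ketbra (w l) (w l)), (fun l => c *: compress_mx Z (w l)).
split=> [l|l x|]; first exact: psd_ketbra.
  rewrite /inner -scalemxAl -scalemxAr mxE mulr_ge0 //.
  exact: psd_compress_mx.
apply/matrixP=> i j.
case: (mxtens_indexP i) => i1 a; case: (mxtens_indexP j) => j1 b.
rewrite tens_id_mxE scale_lfunE sum_lfunE mxE summxE mulr_sumr summxE.
apply: eq_bigr => l _; rewrite tensmxE Ad_ketbra ![(_ *: _ : 'M_(_, _)) _ _]mxE.
have -> : compress_mx Z (w l) a b = inner (w l) (tens_block Z a b *m w l).
  by rewrite mxE.
ring.
Qed.

End RankOneProjections.

(** * The channel of an equiangular tight frame *)

Lemma etf_coherence_lt1 (F : numFieldType) (d N : nat) :
  (2 <= d)%N -> (d <= N <= 2 * d - 2)%N ->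
  N.+1%:R * ((N%:R - d%:R) / (d%:R * (N%:R - 1))) < 1 :> F.
Proof.
move=> d2 /andP[dN N2].
have N1 : (1 < N)%N by exact: leq_trans dN.
have -> : N%:R - 1 = N.-1%:R :> F by rewrite -[in LHS](ltn_predK N1) -natr1 addrK.
rewrite -natrB // -natrM mulrA -natrM ltr_pdivrMr; last first.
  by rewrite ltr0n muln_gt0 (ltnW d2) -ltnS (ltn_predK N1).
(* With denominators cleared, [(N + 1)(N - d) < d (N - 1)] reduces to [N + 1 < 2 d] on cancelling
   [N]. *)
by rewrite mul1r ltr_nat; nia.
Qed.

Section EquiangularTightFrame.
Variables (R : realType) (d N : nat) (w : 'I_N -> 'cV[R[i]]_d).
Hypotheses (N_gt0 : (0 < N)%N) (w_etf : equiangular_tight_frame w)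
  (N_le : (N <= 2 * d - 2)%N).

Local Notation c := (d%:R / N%:R : R[i]).
Local Notation P k := (ketbra (w k) (w k)).
Local Notation tau := (c *: \sum_k Ad (P k) : 'End('M[R[i]]_d)).
Let K k : 'M[R[i]]_d := sqrtC c *: P k.

(** Subtraction truncates, so [d <= 1] would make [2 * d - 2] zero, against [N_gt0]. *)
Let d_gt1 : (1 < d)%N. Proof. by lia. Qed.
Let c_ge0 : 0 <= c. Proof. by rewrite divr_ge0. Qed.
Let N_neq0 : N%:R != 0 :> R[i]. Proof. by rewrite pnatr_eq0 -lt0n. Qed.
Let d_neq0 : d%:R != 0 :> R[i].
Proof. by rewrite pnatr_eq0 -lt0n ltnW. Qed.
Let c_neq0 : c != 0. Proof. by rewrite mulf_neq0 ?invr_eq0. Qed.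

Let unit_w k : inner (w k) (w k) = 1. Proof. by case: w_etf. Qed.

Let tight : \sum_k P k = (c^-1)%:M.
Proof. by case: w_etf => _ _ ->; rewrite invf_div. Qed.

(** The frame operator has rank [d] and factors through dimension [N]. *)
Let d_le_N : (d <= N)%N.
Proof.
have <- : \rank (\sum_k P k)%R = d.
  by rewrite tight -scalemx1 mxrank_scale_nz ?invr_eq0 ?mxrank1.
have := mul_frame_diag w (const_mx 1).
under eq_bigr do rewrite mxE scale1r.
move=> <-; apply: leq_trans (mxrankM_maxl _ _) _.
exact: leq_trans (mxrankM_maxr _ _) (rank_leq_row _).
Qed.

Let coh k l : k != l ->
  `|inner (w k) (w l)| ^+ 2 = (N%:R - d%:R) / (d%:R * (N%:R - 1)).
Proof.
case: w_etf => _ coh_w _; rewrite neq_ltn => /orP[] lt.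
  by rewrite coh_w ?sqrtCK.
by rewrite inner_conj norm_conjC coh_w ?sqrtCK.
Qed.

Let Nc : N.+1%:R * ((N%:R - d%:R) / (d%:R * (N%:R - 1))) < 1 :> R[i].
Proof. by apply: etf_coherence_lt1; rewrite ?d_le_N. Qed.

Let P_free := ketbra_free unit_w coh Nc.

Let tauE : tau = \sum_k Ad (K k).
Proof.
rewrite scaler_sumr; apply: eq_bigr => k _; rewrite Ad_scale.
by rewrite ger0_norm ?sqrtCK ?sqrtC_ge0.
Qed.

Let rank_P k : \rank (P k) = 1%N.
Proof.
apply/eqP; rewrite eqn_leq lt0n mxrank_eq0; apply/andP; split.
  exact: leq_trans (mxrankM_maxl _ _) (rank_leq_col _).
apply/eqP=> P0; have := ketbraE (w k) (w k) (w k).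
rewrite P0 mul0mx unit_w scale1r => wk0; have /eqP := unit_w k; rewrite -wk0.
by rewrite /inner mulmx0 mxE eq_sym oner_eq0.
Qed.

Lemma etf_channel_UEBTP : UEBTP tau.
Proof.
have EB := sum_Ad_ketbra_EB w c_ge0.
split=> //; first (split; first exact: entanglement_breaking_CP).
  move=> X; rewrite scale_lfunE sum_lfunE mxtraceZ raddf_sum /=.
  rewrite (eq_bigr (fun k => \tr (X *m P k))) => [|k _]; last first.
    rewrite Ad_ketbra mxtraceZ mxtrace_ketbra unit_w mulr1.
    by rewrite /ketbra mulmxA -/(ketbra _ _) mxtrace_ketbra.
  have -> : \sum_k \tr (X *m P k) = \tr (X *m \sum_k P k).
    by rewrite mulmx_sumr raddf_sum.
  by rewrite tight mul_mx_scalar mxtraceZ mulrA divff ?mul1r.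
rewrite /unital scale_lfunE sum_lfunE.
rewrite (eq_bigr (fun k => P k)) => [|k _]; last first.
  by rewrite Ad_ketbra mul1mx unit_w scale1r.
by rewrite tight scale_scalar_mx divff.
Qed.

(** Only one component is identified; exchanging the roles of the two gives the other. *)
Lemma UEBTP_comb_eq (psi1 psi2 : 'End('M[R[i]]_d)) (a b : R[i]) :
  UEBTP psi1 -> UEBTP psi2 -> 0 < a -> 0 <= b ->
  tau = a *: psi1 + b *: psi2 -> psi1 = tau.
Proof.
move=> [_ unital1 EB1] [_ _ EB2] a_gt0 b_ge0 tau_ab.
have d_gt0 := ltnW d_gt1.
have [s1 rank_s1 psi1E] := entanglement_breaking_kraus d_gt0 EB1.
have [s2 rank_s2 psi2E] := entanglement_breaking_kraus d_gt0 EB2.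
have scaleE (e : R[i]) (s : seq 'M[R[i]]_d) : 0 <= e ->
    e *: \sum_(V <- s) Ad V = \sum_(V <- [seq sqrtC e *: V | V <- s]) Ad V.
  move=> e_ge0; rewrite big_map scaler_sumr; apply: eq_bigr => V _.
  by rewrite Ad_scale ger0_norm ?sqrtCK ?sqrtC_ge0.
(* The two rescaled lists together represent [a *: psi1 + b *: psi2], that is [tau], so each of
   their members lies in the span of the [K k]. *)
have spanK := @kraus_span _ _ _ K
  ([seq sqrtC a *: V | V <- s1] ++ [seq sqrtC b *: V | V <- s2]).
rewrite -tauE big_cat -!scaleE ?(ltW a_gt0) // -psi1E -psi2E in spanK.
have {}spanK := spanK tau_ab.
have [p psi1p] : exists p : 'rV[R[i]]_N, psi1 = \sum_k p 0 k *: Ad (P k).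
  rewrite psi1E big_seq; apply: (big_ind (fun phi : 'End('M[R[i]]_d) =>
      exists p : 'rV[R[i]]_N, phi = \sum_k p 0 k *: Ad (P k))).
  - by exists 0; rewrite big1 // => k _; rewrite mxE scale0r.
  - move=> _ _ [p ->] [q ->]; exists (p + q); rewrite -big_split.
    by apply: eq_bigr => k _; rewrite mxE scalerDl.
  move=> V s1V; have [x Vx] : exists x : 'rV[R[i]]_N, V = \sum_k x 0 k *: P k.
    have [x Vx] : exists x : 'rV[R[i]]_N, sqrtC a *: V = \sum_k x 0 k *: K k.
      by apply: spanK; rewrite mem_cat map_f.
    (* This factor undoes the scalings in [K] and in [sqrtC a *: V]. *)
    exists ((sqrtC c / sqrtC a) *: x).
    have a_neq0 : sqrtC a != 0 by rewrite sqrtC_eq0 gt_eqF.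
    apply: (scalerI a_neq0); rewrite Vx scaler_sumr; apply: eq_bigr => k _.
    by rewrite mxE /K !scalerA; congr (_ *: _); field.
  have [k [e Ve]] : exists k e, V = e *: P k.
    rewrite Vx; apply: (rank1_combP unit_w coh Nc N_gt0).
    by rewrite -Vx rank_s1.
  exists (\row_l (if l == k then `|e| ^+ 2 else 0)).
  rewrite (bigD1 k) //= big1 ?addr0 => [|l /negPf lk]; last first.
    by rewrite mxE lk scale0r.
  by rewrite mxE eqxx Ve Ad_scale.
(* Evaluated at the identity, [psi1] gives [\sum_k p 0 k *: P k], while tightness writes the
   identity as [c *: \sum_k P k]; independence compares coefficients. *)
have /P_free/rowP p_c : \sum_k (p - const_mx c) 0 k *: P k = 0.
  under eq_bigr do rewrite !mxE scalerBl.
  rewrite sumrB -scaler_sumr tight scale_scalar_mx divff // -unital1 psi1p.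
  rewrite sum_lfunE; apply/eqP; rewrite subr_eq0; apply/eqP/eq_bigr=> k _.
  by rewrite scale_lfunE Ad_ketbra mul1mx unit_w scale1r.
rewrite psi1p scaler_sumr; apply: eq_bigr => k _; congr (_ *: _).
by have /eqP := p_c k; rewrite !mxE subr_eq0 => /eqP.
Qed.

Lemma etf_channel_extreme : extreme_point (@UEBTP R d) tau.
Proof.
split; first exact: etf_channel_UEBTP.
move=> psi1 psi2 t U1 U2 /andP[t_gt0 t_lt1] tauE12.
have t_gt0C : 0 < t%:C by rewrite ltcR.
have t_lt1C : 0 < (1 - t)%:C by rewrite ltcR subr_gt0.
split; first exact: UEBTP_comb_eq U1 U2 t_gt0C (ltW t_lt1C) tauE12.
by apply: UEBTP_comb_eq U2 U1 t_lt1C (ltW t_gt0C) _; rewrite addrC.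
Qed.

(** Each [K k] is a combination of the [V j], and independence of the [P k] makes the [N] by [n]
    matrix of coefficients row-free. *)
Lemma etf_channel_kraus_ge n (V : 'I_n -> 'M[R[i]]_d) :
  tau = \sum_(j < n) Ad (V j) -> (N <= n)%N.
Proof.
rewrite tauE => KV.
have spanV k : exists x : 'rV[R[i]]_n, K k = \sum_j x 0 j *: V j.
  apply: (@kraus_span _ _ _ V [seq K k | k <- enum 'I_N]); last first.
    by rewrite map_f ?mem_enum.
  by rewrite big_map big_enum.
have [x Kx] := fin_all_exists spanV.
pose M := \matrix_k x k.
suff /eqP <- : row_free M by exact: rank_leq_col.
apply: inj_row_free => u uM0.
have /P_free u0 : \sum_k (sqrtC c *: u) 0 k *: P k = 0.
  transitivity (\sum_j (u *m M) 0 j *: V j); last first.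
    by rewrite uM0 big1 // => j _; rewrite mxE scale0r.
  rewrite (eq_bigr (fun k => \sum_j (u 0 k * M k j) *: V j))
    => [|k _]; last first.
    rewrite mxE mulrC -scalerA -/(K k) Kx scaler_sumr.
    by apply: eq_bigr => j _; rewrite scalerA mxE.
  by rewrite exchange_big; apply: eq_bigr => j _; rewrite mxE scaler_suml.
by apply: (@scalerI _ _ (sqrtC c)); rewrite ?sqrtC_eq0 // u0 scaler0.
Qed.

Lemma etf_channel_choi_rank : choi_rank_eq tau N.
Proof.
split; first by exists K; exact: tauE.
by move=> n [V] /etf_channel_kraus_ge.
Qed.

Lemma etf_channel_EB_rank : EB_rank_eq tau N.
Proof.
split; last by move=> n [V [_ /etf_channel_kraus_ge]].
exists K; split; last exact: tauE.
by move=> k; rewrite mxrank_scale_nz ?sqrtC_eq0.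
Qed.

End EquiangularTightFrame.

Theorem corollary3p12 (R : realType) (d N : nat) (w : 'I_N -> 'cV[R[i]]_d)
    (d_ge1 : (1 <= d)%N) (N_ge1 : (1 <= N)%N)
    (w_etf : equiangular_tight_frame w) (N_le : (N <= 2 * d - 2)%N) :
  let tau : 'End('M[R[i]]_d) :=
    (d%:R / N%:R) *: \sum_(k < N) Ad (ketbra (w k) (w k)) in
  [/\ extreme_point (@UEBTP R d) tau,
      choi_rank_eq tau N
    & EB_rank_eq tau N].
Proof.
by split; [exact: etf_channel_extreme | exact: etf_channel_choi_rank
          | exact: etf_channel_EB_rank].
Qed.
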